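(* Let $f:M\to M$ be a continuous map on a compact, finite-dimensional manifold $M$, let $m$ be the normalized Lebesgue measure on $M$, and let $\Phi=\{\phi_n\}_{n\ge 1}$ be a subadditive potential on $M$. Assume that $K$ is an $\alpha$-observable Milnor-like attractor for some $0<\alpha\le1$, and let $B(K)$ be its basin. If for each observable measure $\mu\in\mathcal O_{f|_{B(K)}}$ the growth rates satisfy $$\Phi^*(x):=\lim_{n\to\infty}\frac1n\phi_n(x)<0\quad\text{for }\mu\text{-a.e. }x\in M,$$ then $\widetilde\Phi^*(x)<0$ for $m$-almost every $x\in B(K)$.
   Context: $\mathcal M$ denotes the set of all Borel probability measures on $M$ with the weak$^*$ topology, and $\mathrm{dist}^*$ is a fixed metric on $\mathcal M$ inducing this topology. $\mathcal N_\epsilon(\mu)$ is the $\epsilon$-neighborhood of $\mu\in\mathcal M$ in the metric $\mathrm{dist}^*$. For $x\in M$, the empirical measures are $\delta_{x,n}=\frac1n\sum_{j=0}^{n-1}\delta_{f^j(x)}$, where $\delta_y$ is the Dirac measure at $y$. $\mathcal V_f(x)$ is the set of all weak$^*$ limits of convergent subsequences of $(\delta_{x,n})_{n\ge1}$. Let $B\subset M$ be forward invariant ($f(B)\subset B$) with positive Lebesgue measure. A probability measure $\mu\in\mathcal M$ is observable for $f|_B$ if for all $\epsilon>0$ the set $A_\epsilon(B,\mu):=\{x\in B:\mathcal V_f(x)\cap\mathcal N_\epsilon(\mu)\ne\emptyset\}$ has positive Lebesgue measure. $\mathcal O_{f|_B}$ is the set of all observable measures for $f|_B$. (Observable measures are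 $f$-invariant.) Let $K\subset M$ be nonempty, compact and $f$-invariant, i.e. $f^{-1}(K)=K$. $K$ is a Milnor-like attractor if the set $$B(K):=\Big\{x\in M:\liminf_{n\to\infty}\tfrac1n\,\sharp\{0\le j\le n-1: f^j(x)\in\mathcal N_\epsilon(K)\}=1\ \ \forall\epsilon>0\Big\}$$ has positive Lebesgue measure, where $\sharp$ denotes cardinality and $\mathcal N_\epsilon(K)=\bigcup_{x\in K}B(x,\epsilon)$ is the $\epsilon$-neighborhood of $K$, with $B(x,\epsilon)$ the ball of radius $\epsilon$ centered at $x$. The set $B(K)$ is called the basin of $K$; it is forward invariant. For $0<\alpha\le1$, a Milnor-like attractor $K$ is $\alpha$-observable if $m(B(K))\ge\alpha$. A subadditive potential on $M$ is a sequence $\Phi=\{\phi_n\}_{n\ge1}$ of continuous real functions on $M$ with $\phi_{n+m}(x)\le\phi_n(x)+\phi_m(f^n x)$ for all $x\in M$ and $n,m\in\mathbb N$ (positive integers). By Kingman's subadditive ergodic theorem the limit $\Phi^*(x)$ exists (possibly $-\infty$) for $\mu$-a.e. $x$, for every $f$-invariant probability $\mu$. The largest growth rate at any $x\in M$ is $\widetilde\Phi^*(x):=\limsup_{n\to\infty}\frac1n\phi_n(x)$. *)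

(* Defs.v *)
From HB Require Import structures.
From mathcomp Require Import all_boot all_order all_algebra.
From mathcomp Require Import all_classical all_reals all_analysis.

Set Implicit Arguments.
Unset Strict Implicit.
Unset Printing Implicit Defensive.
Import Order.TTheory GRing.Theory Num.Theory.
Import numFieldNormedType.Exports.
Local Open Scope classical_set_scope.
Local Open Scope ring_scope.
Local Open Scope measure_scope.

(* Measurable types are pointed in the library and metric types are not. *)
#[short(type="pmetricType")]
HB.structure Definition PointedMetric (R : numDomainType) :=
  {M of Pointed M & Metric R M}.

Notation borel T := (g_sigma_algebraType (@open T)).

(* Tonelli's formula: the measure of A is the integral over its first
   coordinate x of the measure of the slice of A at x. *)
Fixpoint lebesgue_rV (R : realType) (d : nat) : set (borel 'rV[R]_d) -> \bar R :=
  match d return set 'rV[R]_d -> \bar R with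
  | 0 => fun A => (\1_A 0)%:E
  | d'.+1 => fun A => (\int[@lebesgue_measure R]_x
      lebesgue_rV [set v : 'rV[R]_d' |
        A (row_mx (const_mx x : 'rV[R]_1) v : 'rV[R]_(1 + d'))])%E
  end.

Record chart (R : realType) (M : Type) (d : nat) := Chart {
  chart_dom : set M ;
  chart_map : M -> 'rV[R]_d ;
  chart_inv : 'rV[R]_d -> M }.

Definition chart_img (R : realType) (M : Type) d (c : chart R M d) :
  set 'rV[R]_d := chart_map c @` chart_dom c.

Definition is_chart (R : realType) (M : topologicalType) d (c : chart R M d) :=
  [/\ open (chart_dom c), open (chart_img c),
      {within chart_dom c, continuous (chart_map c)},
      {within chart_img c, continuous (chart_inv c)} &
      forall x, chart_dom c x -> chart_inv c (chart_map c x) = x].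

(* meant for open W *)
Definition C1_on (R : realType) d (W : set 'rV[R]_d)
    (h : 'rV[R]_d -> 'rV[R]_d) :=
  (forall y, W y -> differentiable h y) /\
  (forall v, {within W, continuous ('D_v h)}).

(* A compact C^1 manifold without boundary, of dimension d; the Lebesgue
   measure class needs at least C^1 changes of charts.  Hausdorffness and
   second countability come from the metric and from compactness. *)
Definition compact_manifold (R : realType) (M : pmetricType R) d
    (atlas : set (chart R M d)) :=
  [/\ compact [set: M],
      forall c, atlas c -> is_chart c,
      forall x : M, exists2 c, atlas c & chart_dom c x &
      forall c c', atlas c -> atlas c' ->
        C1_on (chart_map c @` (chart_dom c `&` chart_dom c'))
              (chart_map c' \o chart_inv c)].

(* m is a Lebesgue (volume) measure of the manifold: in every chart it has a
   positive continuous density, as sqrt (det g) is for a Riemannian metric g.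
   It is normalized because m is a probability. *)
Definition is_lebesgue (R : realType) (M : pmetricType R) d
    (atlas : set (chart R M d)) (m : probability (borel M) R) :=
  forall c, atlas c -> exists rho : 'rV[R]_d -> R,
    [/\ forall y, chart_img c y -> 0 < rho y,
        {within chart_img c, continuous rho} &
        forall A : set (borel M), measurable A -> A `<=` chart_dom c ->
          m A = (\int[@lebesgue_rV R d]_(y in chart_map c @` A) (rho y)%:E)%E].

Section weak_star_topology.
Context {R : realType} (M : pmetricType R).

(* the coarsest topology that makes mu |-> \int[mu]_x g x continuous for
   every continuous g *)
Definition weak_star : Type :=
  sup_topology (fun g : {g : M -> R | continuous g} =>
    Topological.class (initial_topology
      (fun mu : probability (borel M) R => \int[mu]_x sval g x))).

HB.instance Definition _ := Topological.copy weak_star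
  (sup_topology (fun g : {g : M -> R | continuous g} =>
    Topological.class (initial_topology
      (fun mu : probability (borel M) R => \int[mu]_x sval g x)))).

(* dist is a metric on Borel probability measures that induces the weak*
   topology.  A measure of the library is a function of all sets, whose values
   outside the Borel sets are irrelevant: the first clause compares Borel sets. *)
Definition weak_star_metric
    (dist : probability (borel M) R -> probability (borel M) R -> R) :=
  [/\ forall mu nu, dist mu nu = 0 <->
        forall A, measurable A -> mu A = nu A,
      forall mu nu, dist mu nu = dist nu mu,
      forall mu nu xi, dist mu xi <= dist mu nu + dist nu xi &
      forall mu : weak_star, nbhs mu =
        filter_from [set e : R | 0 < e] (fun e => [set nu | dist mu nu < e])].

Lemma weak_star_cvgP (F : set_system weak_star)
    (mu : probability (borel M) R) :
  Filter F ->
  F --> (mu : weak_star) <-> forall g : M -> R, continuous g ->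
    (fun nu : probability (borel M) R => \int[nu]_x g x) @ F
      --> \int[mu]_x g x.
Proof.
move=> FF; split=> [/cvg_sup Fmu g cg A Ag|H].
  have := @initial_continuous (probability (borel M) R) R
    (fun nu => \int[nu]_x g x) mu A Ag.
  exact: Fmu (exist _ g cg) _.
apply/cvg_sup => -[g cg] A [_ [[B oB <-] Bmu] BA].
apply: filterS BA _; apply: H => //; exact: open_nbhs_nbhs.
Qed.

End weak_star_topology.

Section empirical_measures.
Context {R : realType} (M : pmetricType R) (f : M -> M) (x : M).
Local Open Scope ereal_scope.

(* empirical n is the average of the Dirac measures of the first n + 1 points
   of the orbit: the sequence indexed by n >= 1 is shifted by one. *)
Definition empirical (n : nat) : set (borel M) -> \bar R :=
  mscale (n.+1%:R^-1)%:nng%R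
    (msum (fun j => dirac (iter j f x : borel M)) n.+1).

HB.instance Definition _ n := Measure.on (empirical n).

Let empirical_setT n : empirical n setT = 1.
Proof.
rewrite /empirical /= /mscale/= /msum/=.
under eq_bigr do rewrite diracT.
by rewrite sumEFin -EFinM sumr_const card_ord mulVf.
Qed.

HB.instance Definition _ n :=
  Measure_isProbability.Build _ _ _ (empirical n) (empirical_setT n).

End empirical_measures.

Section observability.
Context {R : realType} (M : pmetricType R) (f : M -> M).
Context (m : probability (borel M) R).

Definition limit_measures (x : M) : set (probability (borel M) R) :=
  [set mu | exists2 k : nat -> nat, {homo k : i j / (i < j)%N} &
    (fun i => (empirical f x (k i) : probability (borel M) R) : weak_star M)
      @ \oo --> (mu : weak_star M)].

(* m^* is the outer measure of m: it agrees with m on Borel sets and with the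
   completion of m on Lebesgue measurable sets, while the values of m itself
   outside the Borel sets are meaningless. *)
Definition observable
    (dist : probability (borel M) R -> probability (borel M) R -> R)
    (B : set M) (mu : probability (borel M) R) :=
  forall e : R, 0 < e ->
    (0 < m^* [set x | B x /\
               limit_measures x `&` [set nu | (dist mu nu < e)%R] !=set0])%E.

Definition neighborhood (K : set M) (e : R) : set M := \bigcup_(x in K) ball x e.

(* The term of index 0 is 0 and does not change the lower limit. *)
Definition basin (K : set M) : set M :=
  [set x | forall e : R, 0 < e ->
    limn_einf (fun n =>
      (n%:R^-1 * #|[pred j : 'I_n | iter j f x \in neighborhood K e]|%:R : R)%:E)
    = 1%E].

Definition milnor_like_attractor (K : set M) :=
  [/\ K !=set0, compact K, f @^-1` K = K & (0 < m^* (basin K))%E].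

Definition observable_attractor (alpha : R) (K : set M) :=
  milnor_like_attractor K /\ (alpha%:E <= m^* (basin K))%E.

End observability.

Section subadditive_potentials.
Context {R : realType} (M : pmetricType R) (f : M -> M).

(* phi 0 is not part of the potential *)
Definition subadditive_potential (phi : nat -> M -> R) :=
  (forall n, (0 < n)%N -> continuous (phi n)) /\
  (forall n k x, (0 < n)%N -> (0 < k)%N ->
    phi (n + k)%N x <= phi n x + phi k (iter n f x)).

Definition growth (phi : nat -> M -> R) (x : M) (n : nat) : \bar R :=
  (n%:R^-1 * phi n x)%:E.

End subadditive_potentials.

(* Main.v *)
(* Almost every point of the basin has all its limit measures observable, since
   the weak* compact metrizable space of probability measures is covered, up to
   the observable measures, by countably many balls that only a null set of
   points approaches.  If phi_n(x) / n had a nonnegative upper limit at such a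
   point x, the empirical measures of x along suitable times would converge to
   an observable mu.  Summing subadditivity over l consecutive indices bounds
   l * phi_n(x) / n by the empirical average of phi_l, up to O(1/n), so that
   the integral of phi_l against mu would be nonnegative for every l > 0, which
   Fatou's lemma excludes when phi_n / n tends mu-a.e. to a negative limit.
   Compactness of the space of measures is proved by coding M through nested
   finite Borel partitions: along an ultrafilter, the masses of the cells
   converge, and the limit masses cut [0, 1[ into nested intervals; the map
   sending a point of [0, 1[ to a point of M with the same code transports
   Lebesgue measure to the limit. *)
Require Import Defs.
From HB Require Import structures.
From mathcomp Require Import all_boot all_order all_algebra.
From mathcomp Require Import all_classical all_reals all_analysis.
From mathcomp Require Import measurable_realfun ring lra.
Import Order.TTheory GRing.Theory Num.Theory.
Import numFieldNormedType.Exports.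
Local Open Scope classical_set_scope.
Local Open Scope ring_scope.
Set Implicit Arguments.
Unset Strict Implicit.
Unset Printing Implicit Defensive.

(** * Compactness: finite nets, boundedness and uniform continuity *)

(** Without a finite net, the sets of points missed by finitely many [B x] generate a proper filter.
    At a cluster point [p] of it, the neighbourhood [B p] would meet the set of points outside
    [B p]. *)
Lemma compact_finite_net (T : topologicalType) (B : T -> set T) :
  compact [set: T] -> (forall x, nbhs x (B x)) ->
  exists2 D : set T, finite_set D & forall y, exists2 x, D x & B x y.
Proof.
move=> cT nB; apply: contrapT => noD.
pose F := filter_from (@finite_set T) (fun D => [set y | forall x, D x -> ~ B x y]).
have FF : ProperFilter F.
  apply: filter_from_proper => [|D finD].
    apply: filter_from_filter; first by exists set0.
    move=> D E fD fE; exists (D `|` E); first by rewrite finite_setU.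
    by move=> y DE; split=> x ?; apply: DE; [left|right].
  apply: contrapT => /nonemptyPn D0; apply: noD; exists D => // y.
  apply: contrapT => yD; suff : set0 y by [].
  by rewrite -D0 /= => x Dx Bxy; apply: yD; exists x.
have [p [_ Fp]] := cT F FF filterT.
have Fnp : F [set y | forall x, [set p] x -> ~ B x y].
  by exists [set p] => //; exact: finite_set1.
by have [y [/(_ p erefl)]] := Fp _ _ Fnp (nB p).
Qed.

Lemma continuous_compact_bounded (R : realType) (T : topologicalType)
    (g : T -> R) :
  compact [set: T] -> continuous g -> exists C : R, forall x, `|g x| <= C.
Proof.
move=> cT cg.
have /compact_bounded [C [_ gC]] : compact (g @` [set: T]).
  by apply: continuous_compact => //; exact: continuous_subspaceT.
by exists (C + 1) => x; apply: gC; [rewrite ltrDl|exists x].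
Qed.

Lemma compact_uniform_continuity (R : realType) (T : pseudoMetricType R)
    (g : T -> R) (e : R) :
  compact [set: T] -> continuous g -> 0 < e ->
  exists2 r, 0 < r & forall x y, ball x r y -> `|g x - g y| < e.
Proof.
move=> /compact_near_coveringP cT cg e0.
have e20 : 0 < e / 2 by rewrite divr_gt0.
have := cT R 0^'+ (fun r x => forall y, ball x r y -> `|g x - g y| < e).
move=> /(_ _ _)/wrap[].
  move=> x _; have /nbhs_ballP[r /= r0 rg] := cg x (ball (g x) (e / 2)) (nbhsx_ballx _ _ e20).
  have r20 : 0 < r / 2 by rewrite divr_gt0.
  exists (ball x (r / 2), [set t | t < r / 2]) => /=.
    by split; [exact: nbhsx_ballx|exact: nbhs_right_lt].
  move=> [z t] /= [xz tr] y zy.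
  have xy : ball x r y.
    by rewrite [r]splitr; apply: ball_triangle xz _; apply: le_ball zy; exact: ltW.
  have {}xz : ball x r z by apply: le_ball xz; rewrite ler_pdivrMr// ler_pMr ?ler1n.
  rewrite (_ : g z - g y = (g x - g y) - (g x - g z)); last by ring.
  by rewrite (le_lt_trans (ler_normB _ _))// [e]splitr ltrD//; exact: rg.
move=> cg'.
have [r [r0 rP]] : exists r, 0 < r /\
    [set: T] `<=` (fun x => forall y, ball x r y -> `|g x - g y| < e).
  near (0:R)^'+ => r; exists r; split; near: r; first exact: nbhs_right_gt.
  exact: cg'.
by exists r => // x y; exact: rP.
Unshelve. all: end_near. Qed.

(** * Subadditive potentials compared with orbit sums *)

Lemma subadditive_average (R : realType) (M : pmetricType R) (f : M -> M)
    (phi : nat -> M -> R) (l : nat) :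
  compact [set: M] -> subadditive_potential f phi -> (0 < l)%N ->
  exists C, forall n x, (0 < n)%N ->
    l%:R * phi n x <= \sum_(j < n) phi l (iter j f x) + C.
Proof.
move=> cM [cphi sphi] l0.
have [D phiD] : exists D : nat -> R, forall k x, (0 < k)%N -> `|phi k x| <= D k.
  have /choice[D DP] : forall k, exists C : R, forall x, (0 < k)%N -> `|phi k x| <= C.
    move=> [|k]; first by exists 0.
    have [C CP] := continuous_compact_bounded cM (cphi k.+1 isT).
    by exists C => x _; exact: CP.
  by exists D => k x; exact: DP.
(* A sum in place of a maximum: its terms are nonnegative, so it bounds each [phi k] with
   [0 < k <= l]. *)
pose B := \sum_(k < l) D k.+1.
have D0 k : 0 <= D k.+1 by exact: le_trans (phiD k.+1 point isT).
have B0 : 0 <= B by exact: sumr_ge0.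
have phiB k x : (0 < k <= l)%N -> `|phi k x| <= B.
  case: k => // k /= kl; apply: le_trans (phiD _ _ _) _ => //.
  by rewrite /B (bigD1 (Ordinal kl))//= lerDl sumr_ge0.
have phiBr k x : (0 < k <= l)%N -> phi k x <= B.
  by move=> kl; apply: le_trans (ler_norm _) (phiB _ _ kl).
have phiBl k x : (0 < k <= l)%N -> - B <= phi k x.
  by move=> kl; rewrite lerNl (le_trans _ (phiB k x kl))// -normrN ler_norm.
pose S n x := \sum_(j < n) phi l (iter j f x).
have SB n k x : S n x - k%:R * B <= S (n + k)%N x.
  rewrite /S big_split_ord /= lerD2l lerNl -sumrN mulr_natl.
  rewrite -[X in B *+ X]card_ord -sumr_const; apply: ler_sum => j _.
  by rewrite lerNl phiBl// l0 leqnn.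
(* For [l < n], one [l * B] pays for [W 1], one for replacing [phi n] by the terms of [W], and one
   for the last [l] terms of [S n x]; the remaining [B] pays for [- phi l x]. *)
exists ((3 * l%:R + 1) * B) => n x n0.
have [nl|ln] := leqP n l.
  have := SB 0 n x; rewrite add0n {1}/S big_ord0 sub0r => SnB.
  have : n%:R * B <= l%:R * B by rewrite ler_wpM2r// ler_nat.
  have : l%:R * phi n x <= l%:R * B by rewrite ler_wpM2l// phiBr// n0.
  have : 0 <= l%:R * B by rewrite mulr_ge0.
  by rewrite -/(S n x); lra.
(* A telescoping sum: W (n+1) - W n = phi (n + l) - phi n <= phi l o f^n. *)
pose W n := \sum_(r < l) phi (n + r)%N x.
have WS k : W k.+1 <= W 1 + (S k.+1 x - phi l x).
  elim: k => [|k IH]; first by rewrite /S big_ord1 subrr addr0.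
  rewrite /S big_ord_recr /= -/(S k.+1 x).
  suff : W k.+2 <= W k.+1 + phi l (f (iter k f x)) by move: IH; lra.
  (* Splitting off the last and then the first of these [l + 1] terms relates two consecutive values
     of [W]. *)
  have : \sum_(r < l.+1) phi (k.+1 + r)%N x = W k.+1 + phi (k.+1 + l)%N x.
    by rewrite big_ord_recr.
  rewrite big_ord_recl /= addn0.
  rewrite (eq_bigr (fun r : 'I_l => phi (k.+2 + r)%N x)) => [|r _]; last first.
    by rewrite /bump leq0n addnA addn1.
  rewrite -/(W k.+2) => WE; have := sphi k.+1 l x isT l0.
  by move: WE; rewrite /=; lra.
have [k nE] : exists k, n = (k.+1 + l)%N.
  by exists (n - l).-1; rewrite prednK ?subn_gt0// subnK// ltnW.
have nW : l%:R * phi n x <= W k.+1 + l%:R * B.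
  rewrite !mulr_natl -[X in _ *+ X <= _]card_ord -[X in _ + _ *+ X]card_ord.
  rewrite -!sumr_const /W -big_split.
  apply: ler_sum => r _ /=.
  have rl : (0 < l - r <= l)%N by rewrite subn_gt0 ltn_ord leq_subr.
  rewrite nE -{1}(subnKC (ltnW (ltn_ord r))) addnA.
  apply: le_trans (sphi _ _ _ _ _) _ => //; first by case/andP: rl.
  by rewrite lerD2l phiBr.
have W1 : W 1 <= l%:R * B.
  rewrite mulr_natl -[X in _ *+ X]card_ord -sumr_const.
  by apply: ler_sum => r _; rewrite phiBr//= add1n ltn_ord.
have := SB k.+1 l x; rewrite -nE; have := WS k.
have : - B <= phi l x by rewrite phiBl// l0 leqnn.
by rewrite -/(S n x); move: nW W1; lra.
Qed.

(** * Integrals of continuous functions and of the potential *)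

Lemma continuous_borel_measurable (R : realType) (M : pmetricType R)
    (g : M -> R) : continuous g -> measurable_fun [set: borel M] g.
Proof.
move=> cg; apply: (measurability _ (RGenOpens.measurableE R)).
move=> _ [_ [a [b ->] <-]]; rewrite setTI; apply: sub_sigma_algebra => /=.
by move/continuousP: cg; apply; exact: interval_open.
Qed.

Lemma continuous_integrable (R : realType) (M : pmetricType R)
    (mu : probability (borel M) R) (g : M -> R) :
  compact [set: M] -> continuous g -> mu.-integrable setT (EFin \o g).
Proof.
move=> cM cg; have [C gC] := continuous_compact_bounded cM cg.
apply: (le_integrable _ _ _ (finite_measure_integrable_cst mu C measurableT)) => //.
  by apply/measurable_EFinP; exact: continuous_borel_measurable.
by move=> x _ /=; rewrite lee_fin (le_trans (gC x))// ler_norm.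
Qed.

Lemma integral_empirical (R : realType) (M : pmetricType R) (f : M -> M)
    (x : M) (n : nat) (g : M -> R) : measurable_fun [set: borel M] g ->
  \int[empirical f x n]_y g y =
    n.+1%:R^-1 * \sum_(j < n.+1) g (iter j f x).
Proof.
have ge0 (h : borel M -> R) : measurable_fun setT h -> (forall y, 0 <= h y) ->
    (\int[empirical f x n]_y (h y)%:E =
      (n.+1%:R^-1 * \sum_(j < n.+1) h (iter j f x))%:E)%E.
  move=> mh h0; have mhE : measurable_fun setT (EFin \o h) by exact/measurable_EFinP.
  rewrite ge0_integral_mscale//; last by move=> y _; rewrite lee_fin.
  rewrite ge0_integral_measure_sum//; last by move=> y _; rewrite lee_fin.
  rewrite EFinM -sumEFin; congr (_ * _)%E; apply: eq_bigr => j _.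
  by rewrite integral_dirac// diracT mul1e.
move=> mg; rewrite /Rintegral integralE.
rewrite funerpos funerneg !ge0//; [|exact: measurable_funrneg|exact: measurable_funrpos].
rewrite -EFinB/= -mulrBr -sumrB; congr (_ * _); apply: eq_bigr => j _.
by rewrite -[in RHS](funrposBneg g).
Qed.

Lemma ae_not_False d (T : measurableType d) (R : realType) (P : probability T R) :
  ~ {ae P, forall x : T, False}.
Proof.
case=> A [mA A0 TA]; have AT : A = setT by apply/seteqP; split=> // x _; apply: TA.
by move/eqP: A0; rewrite AT probability_setT onee_eq0.
Qed.

(* Fatou's lemma suffices in place of Kingman's theorem, as the limit is
   assumed to exist almost everywhere. *)
Lemma exists_integral_lt0 (R : realType) (M : pmetricType R) (f : M -> M)
    (phi : nat -> M -> R) (mu : probability (borel M) R) :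
  compact [set: M] -> subadditive_potential f phi ->
  {ae mu, forall x : M,
      cvgn (growth phi x) /\ (limn (growth phi x) < 0)%E} ->
  exists2 l : nat, (0 < l)%N & \int[mu]_x phi l x < 0.
Proof.
move=> cM sub ae_lt0; apply: contrapT => all_ge0.
have {}all_ge0 l : 0 <= \int[mu]_x phi l.+1 x.
  by rewrite leNgt; apply/negP => int0; apply: all_ge0; exists l.+1.
have [cphi sphi] := sub.
have [C phiC] := continuous_compact_bounded cM (cphi 1 isT).
have phiCn n x : phi n.+1 x <= n.+1%:R * C.
  elim: n => [|n IH] in x *.
    by rewrite mul1r (le_trans (ler_norm _))// phiC.
  rewrite -addn1 (le_trans (sphi _ _ _ _ _))// natrD mulrDl lerD//.
  by rewrite mul1r (le_trans (ler_norm _))// phiC.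
(* Subadditivity gives [phi n <= n * C], so these functions are nonnegative and Fatou's lemma
   applies to them. The shift of the index skips [phi 0]. *)
pose u n x := (C%:E - growth phi x n.+1)%E.
have u0 n x : (0 <= u n x)%E.
  by rewrite /u -EFinB lee_fin subr_ge0 mulrC ler_pdivrMr// mulrC phiCn.
have cv n : continuous (fun x => n.+1%:R^-1 * phi n.+1 x : R).
  by move=> x; apply: cvgM; [exact: cvg_cst|exact: cphi].
have mu_ n : measurable_fun [set: borel M] (u n).
  apply/measurable_EFinP/measurable_funB => //.
  exact: continuous_borel_measurable.
have intu n : (\int[mu]_x u n x <= C%:E)%E.
  have iv := continuous_integrable mu cM (cv n).
  have iC := finite_measure_integrable_cst mu C measurableT.
  rewrite [X in (X <= _)%E](_ : _ =
    (\int[mu]_x (C - n.+1%:R^-1 * phi n.+1 x))%:E); last first.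
    rewrite /Rintegral fineK//; apply: integrable_fin_num => //.
    exact: (integrableB measurableT iC iv).
  rewrite RintegralB// RintegralZl//; last exact/continuous_integrable/cphi.
  rewrite Rintegral_cst//.
  have muT : fine (mu [set: borel M]) = 1 by rewrite probability_setT.
  rewrite [X in C * X]muT.
  rewrite mulr1 lee_fin gerBl.
  by rewrite mulr_ge0.
pose L x := limn_einf (u^~ x).
have mL : measurable_fun [set: borel M] L.
  rewrite (_ : L = fun x => (- limn_esup (fun n => - u n x))%E); last first.
    by apply/funext => x; rewrite (limn_esupN (u^~ x)) oppeK.
  apply: measurableT_comp => //; apply: measurable_fun_limn_esup => n.
  exact: measurableT_comp.
have L0 x : (0 <= L x)%E.
  rewrite /L limn_einf_lim; apply: lime_ge; first exact: is_cvg_einfs.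
  by apply: nearW => n; apply: le_ereal_inf_tmp => _ [k _ <-].
have intL : (\int[mu]_x L x <= C%:E)%E.
  apply: le_trans (fatou mu measurableT mu_ (fun n x _ => u0 n x)) _.
  rewrite limn_einf_lim; apply: lime_le; first exact: is_cvg_einfs.
  apply: nearW => n; apply: le_trans (intu n).
  by apply: ereal_inf_lbound; exists n => /=.
have ltL : {ae mu, forall x : M, (C%:E < L x)%E}.
  apply: (@filterS _ _ (ae_filter_ringOfSetsType mu)) ae_lt0 => x [cvgx limx].
  have -> : L x = (C%:E - limn (growth phi x))%E.
    apply: (cvg_limn_einf_sup (u := u^~ x) _).1.
    apply: cvgeB => //; first exact: cvg_cst.
    by rewrite (cvg_shiftS (growth phi x)).
  by rewrite -[ltLHS]adde0 lteD2lE// oppe_gt0.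
(* Almost everywhere [L] exceeds [C], so [h] is positive there, while the integral of [L] is at most
   [C], so [h] must vanish almost everywhere. The truncation keeps [h] nonnegative on the
   exceptional set; [L] is infinite where the growth rate is minus infinity. *)
pose h x : \bar R := maxe (L x - C%:E)%E 0%E.
have mh : measurable_fun [set: borel M] h.
  by apply: measurable_maxe => //; exact: emeasurable_funB.
have h0 x : (0 <= h x)%E by rewrite /h le_max lexx orbT.
have Lh : ae_eq mu setT L (fun x => h x + C%:E)%E.
  apply: (@filterS _ _ (ae_filter_ringOfSetsType mu)) ltL => x CL _.
  rewrite /h max_l ?subeK//.
  by rewrite sube_ge0// ltW.
have inth : (\int[mu]_x `|h x| = 0)%E.
  rewrite (eq_integral (h : borel M -> \bar R)) => [|x _]; last by rewrite gee0_abs.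
  apply/eqP; rewrite eq_le integral_ge0 ?andbT; last by move=> x _; exact: h0.
  move: intL; rewrite (ae_eq_integral _ _ _ _ _ Lh)//; last exact: emeasurable_funD.
  have C0 : (0 <= C%:E)%E.
    by rewrite lee_fin (le_trans (normr_ge0 (phi 1 point))).
  have intC : (\int[mu]_x cst C%:E x = C%:E)%E.
    by rewrite integral_cst// -[RHS]mule1; congr (_ * _)%E; exact: probability_setT.
  by rewrite ge0_integralD// [X in (_ + X <= _)%E]intC -leeBrDr// subee.
have h_eq0 := (ae_eq_integral_abs mu measurableT mh).1 inth.
apply: (@ae_not_False _ _ _ mu).
have {}ltL : {ae mu, forall x : borel M, h x = 0%E -> False}.
  apply: (@filterS _ _ (ae_filter_ringOfSetsType mu)) ltL => x CL; apply/eqP.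
  by rewrite gt_eqF// /h lt_max sube_gt0 CL.
by apply: (@filterS2 _ _ (ae_filter_ringOfSetsType mu)) ltL h_eq0 => x hx /(_ I).
Qed.

(** * Weak* compactness of the space of probability measures *)

(** Each fiber of [k] contributes an error of at most [e] times its mass, and the masses of the
    fibers add up to 1. The induction adds the fibers one by one. *)
Lemma integral_step_approx d (T : measurableType d) (R : realType)
    (P : probability T R) (h : T -> R) (k : T -> nat) (N : nat) (v : nat -> R)
    (e : R) :
  P.-integrable setT (EFin \o h) -> (forall a, measurable (k @^-1` [set a])) ->
  (forall t, (k t < N)%N) -> (forall t, `|h t - v (k t)| <= e) ->
  `|\int[P]_t h t - \sum_(a < N) v a * fine (P (k @^-1` [set nat_of_ord a]))| <= e.
Proof.
move=> ih mk kN hv; pose E n := [set t | (k t < n)%N].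
have ES n : E n.+1 = E n `|` k @^-1` [set n].
  apply/seteqP; split=> t; rewrite /E /= ltnS.
    by rewrite leq_eqVlt => /orP[/eqP|]; [right|left].
  by move=> [/ltnW|->].
have mE n : measurable (E n).
  elim: n => [|n IH]; last by rewrite ES; exact: measurableU.
  by rewrite (_ : E 0%N = set0)//; apply/seteqP; split=> t.
have EF n : E n `&` k @^-1` [set n] = set0.
  by apply/seteqP; split=> // t [+ /= kn]; rewrite /E /= kn ltnn.
have ihA A : measurable A -> P.-integrable A (EFin \o h).
  by move=> mA; apply: integrableS ih.
have icA A c : measurable A -> P.-integrable A (EFin \o cst c).
  by move=> mA; exact: finite_measure_integrable_cst.
have step n : `|\int[P]_(t in k @^-1` [set n]) h t -
    v n * fine (P (k @^-1` [set n]))| <= e * fine (P (k @^-1` [set n])).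
  rewrite -!Rintegral_cst// -RintegralB//; [|exact: ihA|exact: icA].
  have iB : P.-integrable (k @^-1` [set n]) (EFin \o (fun t => h t - v n)).
    by apply: (integrableB (mk n) (ihA _ (mk n)) (icA _ (v n) (mk n))).
  apply: le_trans (le_normr_Rintegral _ iB) _ => //.
  apply: le_Rintegral => //; [exact: integrable_norm|exact: icA|].
  by move=> t /= <-; exact: hv.
have main n : `|\int[P]_(t in E n) h t -
    \sum_(a < n) v a * fine (P (k @^-1` [set nat_of_ord a]))| <=
    e * fine (P (E n)).
  elim: n => [|n IH].
    rewrite (_ : E 0%N = set0); last by apply/seteqP; split=> t.
    by rewrite Rintegral_set0 big_ord0 subrr normr0 measure0 mulr0.
  have iES : P.-integrable (E n `|` k @^-1` [set n]) (EFin \o h).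
    by rewrite -ES; exact: ihA.
  rewrite ES Rintegral_setU//; last by apply/disj_setPS; rewrite EF.
  rewrite measureU// fineD ?fin_num_measure// mulrDr big_ord_recr/=.
  rewrite opprD addrACA; apply: le_trans (ler_normD _ _) _.
  by rewrite lerD.
have := main N; rewrite (_ : E N = setT) ?probability_setT ?mulr1//.
by apply/seteqP; split=> // t _; exact: kN.
Qed.

(* Each code c k determines the codes of lower index, so that the fibers of
   the functions c k are nested finite partitions. *)
Lemma nested_codes (R : realType) (M : pmetricType R) : compact [set: M] ->
  exists (N W : nat -> nat) (c : nat -> M -> nat),
    [/\ forall k, (0 < N k)%N,
        forall k y, (c k y < W k)%N,
        forall k y, (c k.+1 y %/ N k)%N = c k y,
        forall k a, measurable (c k @^-1` [set a] : set (borel M)) &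
        forall r : R, 0 < r -> exists k, forall x y, c k x = c k y -> ball x r y].
Proof.
move=> cM; have e0 k : 0 < (k.+1%:R^-1 : R) by [].
(* Interiors of balls are open, hence Borel. *)
have /choice[s sP] k : exists s : seq M,
    forall y, has (fun x => `[< ((ball x (k.+1%:R^-1 : R))°) y >]) s.
  have [D /finite_seqP[s ->] DP] := compact_finite_net cM (fun x : M =>
    nbhs_interior (nbhsx_ballx x _ (e0 k))).
  exists s => y; have [x xs xy] := DP y.
  by apply/hasP; exists x => //; exact/asboolP.
(* Taking the first set of the net that contains [y] turns the cover into a partition. *)
pose i k (y : M) := find (fun x => `[< ((ball x (k.+1%:R^-1 : R))°) y >]) (s k).
pose N k := size (s k).
have iN k y : (i k y < N k)%N by rewrite -has_find.
have N0 k : (0 < N k)%N by exact: leq_ltn_trans (iN k point).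
have mi k a : measurable (i k @^-1` [set a] : set (borel M)).
  rewrite /i; elim: (s k) a => [|x l IH] a /=.
    case: a => [|a].
      by rewrite (_ : _ @^-1` _ = setT)//; apply/seteqP; split.
    by rewrite (_ : _ @^-1` _ = set0)//; apply/seteqP; split.
  have mB : measurable ((ball x (k.+1%:R^-1 : R))° : set (borel M)).
    by apply: sub_sigma_algebra; exact: open_interior.
  case: a => [|a].
    rewrite (_ : _ @^-1` _ = (ball x (k.+1%:R^-1 : R))°)//.
    apply/seteqP; split=> y /=; case: ifPn => //; first by move/asboolP.
    by move/asboolP.
  rewrite (_ : _ @^-1` _ = ~` (ball x (k.+1%:R^-1 : R))° `&`
    ((fun y => find (fun x => `[< ((ball x (k.+1%:R^-1 : R))°) y >]) l) @^-1` [set a])).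
    by apply: measurableI; [exact: measurableC|exact: IH].
  apply/seteqP; split=> y /=; case: ifPn => //.
  - by move=> /asboolP ? [].
  - by move=> /asboolP ? [].
  - by move=> /asboolP ? [_ ->].
(* Codes are written in mixed radix, with [i k y] as the new lowest digit in base [N k]: division by
   [N k] drops this digit and the remainder recovers it. *)
pose c := fix c k (y : M) := if k is k'.+1 then (c k' y * N k' + i k' y)%N else 0%N.
pose W := fix W k := if k is k'.+1 then (W k' * N k')%N else 1%N.
exists N, W, c; split=> //.
- elim=> // k IH y /=; rewrite (@leq_trans ((c k y).+1 * N k)%N)//.
    by rewrite mulSn addnC ltn_add2r.
  by rewrite leq_mul2r IH orbT.
- by move=> k y /=; rewrite divnMDl// divn_small// addn0.
- elim=> [|k IH] a /=.
    case: a => [|a].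
      by rewrite (_ : _ @^-1` _ = setT)//; apply/seteqP; split.
    by rewrite (_ : _ @^-1` _ = set0)//; apply/seteqP; split.
  rewrite (_ : _ @^-1` _ =
    (c k @^-1` [set (a %/ N k)%N]) `&` (i k @^-1` [set (a %% N k)%N])).
    exact: measurableI.
  apply/seteqP; split=> y /=.
    by move=> <-; rewrite divnMDl// divn_small// addn0 modnMDl modn_small.
  by move=> [-> ->]; rewrite -divn_eq.
(* Points with the same code at level [k + 1] share the digit [i k], hence lie in one ball of radius
   [1 / (k + 1)]. *)
- move=> r r0; have [k kr] : exists k, 2 * k.+1%:R^-1 < r.
    have [k] := ltr_add_invr (divr_gt0 r0 (ltr0n R 2)).
    by rewrite add0r ltr_pdivlMr// mulrC; exists k.
  exists k.+1 => x y /= cxy.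
  have ixy : i k x = i k y.
    by rewrite -(modn_small (iN k x)) -(modnMDl (c k x)) cxy modnMDl modn_small.
  have iB z : ball (nth point (s k) (i k z)) (k.+1%:R^-1 : R) z.
    apply: (@interior_subset _ (ball (nth point (s k) (i k z)) (k.+1%:R^-1 : R))).
    exact/asboolP/(nth_find _ (sP k z)).
  apply: (@le_ball _ _ _ (k.+1%:R^-1 + k.+1%:R^-1)).
    by rewrite -mulr2n -[leLHS]mulr_natl ltW.
  apply: ball_triangle (iB y); rewrite -ixy; exact/ball_sym.
Qed.

Definition uniform01 (R : realType) : set (measurableTypeR R) -> \bar R :=
  mrestr (@lebesgue_measure R) (measurable_itv `[0, 1[).

HB.instance Definition _ (R : realType) := Measure.on (@uniform01 R).

Lemma uniform01_setT (R : realType) : uniform01 [set: R] = 1%E.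
Proof.
by rewrite /uniform01 /mrestr setTI lebesgue_measure_itv/= lte01 oppr0 adde0.
Qed.

HB.instance Definition _ (R : realType) :=
  Measure_isProbability.Build _ _ _ (@uniform01 R) (@uniform01_setT R).

(** [G k a] plays the role of the total mass of the cells of code less than [a]. The measure is the
    law of a map [T] for which [T t] is a limit of points having the codes of [t]. Since [T t] may
    fall outside these cells, the cells need not receive their prescribed masses; integrals of
    continuous functions are controlled nevertheless. *)
Lemma law_of_codes (R : realType) (M : pmetricType R) (N W : nat -> nat)
    (c : nat -> M -> nat) (G : nat -> nat -> R) :
  compact [set: M] -> (forall k, (0 < N k)%N) ->
  (forall k y, (c k.+1 y %/ N k)%N = c k y) ->
  (forall r : R, 0 < r -> exists k, forall x y, c k x = c k y -> ball x r y) ->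
  (forall k, {homo G k : a b / (a <= b)%N >-> a <= b}) ->
  (forall k, G k 0%N = 0) -> (forall k, G k (W k) = 1) ->
  (forall k a, G k.+1 (a * N k)%N = G k a) ->
  (forall k a, G k a < G k a.+1 -> exists y, c k y = a) ->
  exists mu : probability (borel M) R, forall g : M -> R, continuous g ->
    forall k (v : nat -> R) (e : R), (forall y, `|g y - v (c k y)| <= e) ->
    `|\int[mu]_x g x - \sum_(a < W k) v a * (G k a.+1 - G k a)| <= e.
Proof.
move=> cM N0 cN cball Ghomo G0 G1 GN Gex.
(* Sending the reals outside [[0, 1[] to 0 gives a code to every real; [uniform01] does not charge
   them. *)
pose r : R -> R := id \_ (`[0, 1[%classic : set R).
have r01 t : 0 <= r t < 1.
  rewrite /r patchE; case: ifPn => [|_]; last by rewrite lexx ltr01.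
  by rewrite inE /= in_itv.
have rE t : 0 <= t < 1 -> r t = t.
  by move=> t01; rewrite /r patchE mem_set//= in_itv.
have mr : measurable_fun [set: measurableTypeR R] r.
  by apply: (measurable_restrictT _ _).1.
have /choice[idx_ idxP_] : forall p : nat * R, exists a,
    (a < W p.1)%N /\ G p.1 a <= r p.2 < G p.1 a.+1.
  move=> [k t] /=; have /andP[rt0 rt1] := r01 t.
  have ex : exists a, r t < G k a by exists (W k); rewrite G1.
  (* The least [a] with [r t < G k a] is not 0, because [G k 0 = 0 <= r t]; its predecessor is the
     code of [t]. *)
  case: (ex_minnP ex) => -[|a] rta amin; first by move: rta; rewrite G0 ltNge rt0.
  exists a; split; first by apply: amin; rewrite G1.
  by rewrite rta andbT; case: (leP (G k a) (r t)) => // /amin; rewrite ltnn.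
pose idx k t := idx_ (k, t).
have idxW k t : (idx k t < W k)%N by case: (idxP_ (k, t)).
have idxP k t : G k (idx k t) <= r t < G k (idx k t).+1 by case: (idxP_ (k, t)).
have idx_uniq k t a : G k a <= r t < G k a.+1 -> idx k t = a.
  have le b b' : G k b <= r t < G k b.+1 -> G k b' <= r t < G k b'.+1 -> (b <= b')%N.
    move=> /andP[tb _] /andP[_ tb']; rewrite leqNgt; apply/negP => /(Ghomo k).
    by apply/negP; rewrite -ltNge (le_lt_trans tb tb').
  by move=> ta; apply/eqP; rewrite eqn_leq !le.
have idxN k t : (idx k.+1 t %/ N k)%N = idx k t.
  apply/esym/idx_uniq; rewrite -(GN k (_ %/ _)%N) -(GN k (_ %/ _).+1).
  have /andP[t1 t2] := idxP k.+1 t.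
  rewrite (le_trans _ t1) ?Ghomo ?leq_trunc_div//=.
  by rewrite (lt_le_trans t2)// Ghomo// ltn_ceil.
have cidx t y k j : c (k + j)%N y = idx (k + j)%N t -> c k y = idx k t.
  elim: j => [|j IH]; first by rewrite addn0.
  by rewrite addnS => cy; apply: IH; rewrite -cN cy idxN.
have cidx_ex k t : exists y, c k y = idx k t.
  by apply: Gex; have /andP[] := idxP k t; exact: le_lt_trans.
(* The cells with the codes of [t] are nonempty and nested, so they generate a proper filter; [T t]
   is a cluster point of it. *)
have /choice[T TP] : forall t, exists p : M, forall A : set M, nbhs p A ->
    forall k, exists2 y, A y & c k y = idx k t.
  move=> t; pose F := filter_from [set: nat] (fun k => [set y | c k y = idx k t]).
  have FF : ProperFilter F.
    apply: filter_from_proper; last by move=> k _; have [y yk] := cidx_ex k t; exists y.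
    apply: filter_from_filter; first by exists 0%N.
    move=> i j _ _; exists (i + j)%N => // y /= yij; split; first exact: cidx yij.
    by rewrite addnC in yij; exact: cidx yij.
  have [p [_ Fp]] := cM F FF filterT; exists p => A pA k.
  have [|y [? ?]] := Fp [set y | c k y = idx k t] A _ pA; first by exists k.
  by exists y.
have midx k (Q : set nat) : measurable [set t : measurableTypeR R | Q (idx k t)].
  rewrite (_ : mkset _ = \bigcup_(a in Q) [set t | G k a <= r t < G k a.+1]).
    apply: bigcup_measurable => a _.
    rewrite (_ : mkset _ = r @^-1` `[G k a, G k a.+1[).
      rewrite -[X in measurable X]setTI; apply: (mr measurableT).
      exact: measurable_itv.
    by apply/seteqP; split=> t /=; rewrite in_itv.
  apply/seteqP; split=> t /=; first by move=> Qt; exists (idx k t) => //; exact: idxP.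
  by move=> [a Qa /idx_uniq ->].
have mT : measurable_fun [set: measurableTypeR R] (T : measurableTypeR R -> borel M).
  apply: (@measurability _ _ _ (borel M) setT T (@open M) erefl) => _ [U oU <-].
  rewrite setTI.
  (* [T t] lies in [U] exactly when, at some level, the cell of [t] has a uniform neighbourhood
     inside [U]. This condition depends only on a code, so the preimage is a countable union of
     measurable sets. *)
  pose Q k a := exists2 rho, 0 < rho & forall y, c k y = a -> ball y rho `<=` U.
  rewrite (_ : _ @^-1` _ = \bigcup_k [set t : R | Q k (idx k t)]).
    by apply: bigcup_measurable => k _; exact: (midx k (Q k)).
  apply/seteqP; split=> t /=.
    move=> Ut; have /nbhs_ballP[e /= e0 eU] : nbhs (T t) U by exact: open_nbhs_nbhs.
    have e30 : 0 < e / 3 by rewrite divr_gt0.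
    have [k ck] := cball _ e30; exists k => //; exists (e / 3) => // y yk z yz.
    have [w Tw wk] := TP t _ (nbhsx_ballx _ _ e30) k.
    apply: eU; rewrite (_ : e = e / 3 + e / 3 + e / 3); last by field.
    apply: ball_triangle yz; apply: ball_triangle Tw _.
    by apply: ck; rewrite wk yk.
  move=> [k _ [rho rho0 kU]].
  have [y Ty yk] := TP t _ (nbhsx_ballx _ _ rho0) k.
  by apply: (kU y yk); exact: ball_sym.
have measure_idx k a : (a < W k)%N ->
    fine (uniform01 (idx k @^-1` [set a])) = G k a.+1 - G k a.
  move=> aW; rewrite /uniform01 /mrestr (_ : _ `&` _ = `[G k a, G k a.+1[%classic).
    rewrite lebesgue_measure_itv /= lte_fin; case: ltP => // GaS.
    by apply/esym/eqP; rewrite /= subr_eq0 eq_le GaS Ghomo ?leqnSn.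
  apply/seteqP; split=> t /=; rewrite !in_itv /=.
    by move=> [<- t01]; have := idxP k t; rewrite rE.
  move=> /andP[ta tb].
  have t01 : 0 <= t < 1.
    by rewrite -(G0 k) (le_trans _ ta) ?Ghomo//= (lt_le_trans tb)// -(G1 k) Ghomo.
  by split=> //; apply: idx_uniq; rewrite rE// ta.
pose X := mfun_Sub (mem_set mT : (T : measurableTypeR R -> borel M) \in mfun).
exists (distribution (@uniform01 R) X) => g cg k v e gv.
have mg := continuous_borel_measurable cg.
have mgT : measurable_fun [set: measurableTypeR R] (g \o T).
  exact: (measurableT_comp mg mT).
have [C gC] := continuous_compact_bounded cM cg.
have igT : (@uniform01 R).-integrable setT (EFin \o (g \o T)).
  have icst := finite_measure_integrable_cst (@uniform01 R) C measurableT.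
  apply: (le_integrable _ _ _ icst) => //.
    exact/measurable_EFinP.
  by move=> t _ /=; rewrite lee_fin (le_trans (gC _))// ler_norm.
(* Were the bound violated at [T t], continuity would violate it at a nearby point whose code is
   [idx k t]. *)
have gTv t : `|g (T t) - v (idx k t)| <= e.
  rewrite leNgt; apply/negP; rewrite -subr_gt0 => ge0.
  have [y gy yk] := TP t _ (cg (T t) _ (nbhsx_ballx _ _ ge0)) k.
  have := gv y; rewrite yk leNgt => /negP; apply.
  move: gy; rewrite /= /ball /= => gy.
  rewrite (_ : g y - v (idx k t) =
    (g (T t) - v (idx k t)) - (g (T t) - g y)); last by ring.
  by rewrite (lt_le_trans _ (lerB_dist _ _))// ltrBrDr addrC -ltrBrDr.
have := integral_step_approx igT (fun a => midx k [set a]) (idxW k) gTv.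
rewrite (eq_bigr (fun a : 'I_(W k) => v a * (G k a.+1 - G k a))); last first.
  by move=> a _; congr (_ * _); exact: measure_idx.
have intE : (\int[distribution (@uniform01 R) X]_y (g y)%:E =
    \int[@uniform01 R]_t (g (T t))%:E)%E.
  have mgE : measurable_fun [set: borel M] (EFin \o g) by exact/measurable_EFinP.
  exact: (@integral_distribution _ _ _ _ _ (@uniform01 R) X _ mgE igT).
by rewrite /Rintegral intE.
Qed.

(** The image filter clusters in the compact segment, and an ultrafilter converges to each of its
    cluster points: it contains a set or its complement. *)
Lemma cvg_ultra_bounded (R : realType) (T : Type) (F : set_system T)
    (psi : T -> R) (a b : R) :
  UltraFilter F -> (forall x, a <= psi x <= b) -> exists l : R, psi @ F --> l.
Proof.
move=> UF psi_ab.
have [|l [_ lF]] := @segment_compact R a b (psi @ F) _.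
  by apply: (@filterE _ F) => x; rewrite /= in_itv /=; exact: psi_ab.
exists l => A /nbhs_ballP[e e0 eA]; rewrite /nbhs /=.
have [FA|FA] := in_ultra_setVsetC (psi @^-1` A) UF; first exact: FA.
by have [y [nAy /eA]] := lF (~` A) _ FA (nbhsx_ballx _ _ e0).
Qed.

Theorem weak_star_compact (R : realType) (M : pmetricType R) :
  compact [set: M] -> compact [set: weak_star M].
Proof.
move=> cM; rewrite compact_ultra => F UF _.
have [N [W [c [N0 cW cN mc cball]]]] := nested_codes cM.
have mlt k a : measurable ([set y | (c k y < a)%N] : set (borel M)).
  rewrite (_ : mkset _ = \bigcup_(b in [set b | (b < a)%N]) (c k @^-1` [set b])).
    by apply: bigcup_measurable => b _.
  by apply/seteqP; split=> y /=; [exists (c k y)|move=> [b ? ->]].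
(* Cumulative masses are used, so that their limits are directly the endpoints of the intervals
   coding the cells. *)
pose L k a (nu : probability (borel M) R) := fine (nu [set y | (c k y < a)%N]).
have /choice[G_ GP] : forall p : nat * nat, exists l : R, L p.1 p.2 @ F --> l.
  move=> [k a]; apply: (cvg_ultra_bounded (a := 0) (b := 1)) => nu.
  rewrite /L fine_ge0//= -(_ : fine 1%E = 1)// fine_le ?fin_num_measure//.
  exact: probability_le1.
pose G k a := G_ (k, a).
have {}GP k a : L k a @ F --> G k a by exact: GP.
have L_cst k a (l : R) : (forall nu, L k a nu = l) -> G k a = l.
  move=> Ll; apply: (cvg_unique _ (GP k a)) => //.
  by rewrite (_ : L k a = cst l); [exact: cvg_cst|exact/funext].
have LS k a nu : L k a.+1 nu - L k a nu = fine (nu (c k @^-1` [set a])).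
  rewrite /L (_ : [set y | (c k y < a.+1)%N] =
    [set y | (c k y < a)%N] `|` c k @^-1` [set a]).
    rewrite measureU// ?fineD ?fin_num_measure//; first by rewrite addrC addKr.
    by apply/seteqP; split=> // y [+ /= kn]; rewrite /= kn ltnn.
  apply/seteqP; split=> y; rewrite /= ltnS.
    by rewrite leq_eqVlt => /orP[/eqP|]; [right|left].
  by move=> [/ltnW|->].
have LScvg k a : (fun nu : probability (borel M) R =>
    fine (nu (c k @^-1` [set a]))) @ F --> G k a.+1 - G k a.
  rewrite (_ : (fun nu : probability (borel M) R => _) = L k a.+1 \- L k a).
    by apply: cvgB; exact: GP.
  by apply/funext => nu; rewrite /= LS.
have GS k a : G k a <= G k a.+1.
  rewrite -subr_ge0 -(cvg_lim _ (LScvg k a))//; apply: limr_ge.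
    by apply/cvg_ex; exists (G k a.+1 - G k a); exact: LScvg.
  by apply: nearW => nu; exact: fine_ge0.
have [||||k a Ga|mu muP] := @law_of_codes R M N W c G cM N0 cN cball.
- by move=> k; apply: homo_leq => [x|y x z|a]; [exact: lexx|exact: le_trans|exact: GS].
- move=> k; apply: L_cst => nu; rewrite /L (_ : mkset _ = set0) ?measure0//.
  by apply/seteqP; split.
- move=> k; apply: L_cst => nu; rewrite /L (_ : mkset _ = setT) ?probability_setT//.
  by apply/seteqP; split=> // y _ /=.
- move=> k a; apply: (cvg_unique _ (GP k.+1 (a * N k)%N)) => //.
  rewrite (_ : L k.+1 (a * N k)%N = L k a); first exact: GP.
  apply/funext => nu; rewrite /L; congr (fine (nu _)).
  by apply/seteqP; split=> y; rewrite /= -ltn_divLR// cN.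
(* An empty cell has mass 0 for every measure, hence an empty interval in the limit. *)
- apply: contrapT => noy; move: Ga; rewrite -subr_gt0.
  rewrite (cvg_unique _ (LScvg k a) (_ : _ --> 0)) ?ltxx//.
  rewrite (_ : (fun nu : probability (borel M) R => _) = cst 0); first exact: cvg_cst.
  apply/funext => nu; rewrite (_ : _ @^-1` _ = set0) ?measure0//.
  by apply/seteqP; split=> // y ya; apply: noy; exists y.
exists mu; split=> //; apply/weak_star_cvgP => g cg.
apply/cvgrPdist_le => e e0; have e30 : 0 < e / 3 by rewrite divr_gt0.
have [r r0 rg] := compact_uniform_continuity cM cg e30.
have [k ck] := cball r r0.
(* The value of [g] at a chosen point of the cell; the default point serves only codes that no point
   has. *)
pose v a := g (xget point (c k @^-1` [set a])).
have gv y : `|g y - v (c k y)| <= e / 3.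
  apply/ltW/rg/ck/esym.
  exact: (xgetPex point (ex_intro (c k @^-1` [set c k y]) y erefl)).
have scvg : (fun nu : probability (borel M) R =>
    \sum_(a < W k) v a * fine (nu (c k @^-1` [set nat_of_ord a]))) @ F -->
    \sum_(a < W k) v a * (G k a.+1 - G k a).
  apply: cvg_big => [|a _]; first exact: add_continuous.
  apply: cvgM; first exact: cvg_cst.
  exact: LScvg.
(* Three errors of [e / 3]: the step approximation for [mu], the one for [nu], and the difference of
   the two step sums. *)
move/cvgrPdist_le : scvg => /(_ _ e30); apply: filterS => nu snu.
have := integral_step_approx (continuous_integrable nu cM cg) (mc k) (cW k) gv.
have := muP g cg k v _ gv.
rewrite !ler_norml => /andP[? ?] /andP[? ?].
by move: snu; rewrite ler_norml => /andP[? ?]; apply/andP; split; lra.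
Qed.

(** * Almost every point has only observable limit measures *)

(** The unions of countable measurable covers of total mass below [1 / (n + 1)] intersect in a
    measurable null set containing [Z]. *)
Lemma outer_measure0_negligible d (T : measurableType d) (R : realType)
    (m : {measure set T -> \bar R}) (Z : set T) :
  (m^* Z)%mu = 0%E -> m.-negligible Z.
Proof.
move=> mZ.
have /choice[A AP] n : exists A : (set T)^nat, measurable_cover Z A /\
    (\sum_(k <oo) m (A k) < (n.+1%:R^-1 : R)%:E)%E.
  have /ereal_inf_lt[_ [A ZA <-] Alt] : ((m^* Z)%mu < (n.+1%:R^-1 : R)%:E)%E.
    by rewrite mZ lte_fin.
  by exists A.
pose B := \bigcap_n \bigcup_k A n k.
have mU n : measurable (\bigcup_k A n k).
  by apply: bigcupT_measurable => k; have [[mA _] _] := AP n.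
exists B; split; first exact: bigcapT_measurable.
- apply/eqP; rewrite eq_le measure_ge0 andbT; apply/lee_addgt0Pr => e e0.
  rewrite add0e; have [n nlt] := ltr_add_invr e0.
  apply: (@le_trans _ _ (m (\bigcup_k A n k))).
    apply: le_measure; rewrite ?inE//; first exact: bigcapT_measurable.
    exact: bigcap_inf.
  apply: (@le_trans _ _ (\sum_(k <oo) m (A n k))%E).
    apply: measure_sigma_subadditive => // k; by have [[mA _] _] := AP n.
  have [_ Alt] := AP n; rewrite (le_trans (ltW Alt))// lee_fin ltW//.
  by rewrite add0r in nlt.
- by move=> z Zz n _; have [[_ ZA] _] := AP n; exact: ZA.
Qed.

(* The space of measures is totally bounded, so the non-observable measures are
   covered by countably many balls that are approached only from a null set. *)
Lemma negligible_not_observable (R : realType) (M : pmetricType R)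
    (m : probability (borel M) R)
    (dist : probability (borel M) R -> probability (borel M) R -> R)
    (f : M -> M) (B : set M) :
  compact [set: M] -> weak_star_metric dist ->
  m.-negligible [set x | B x /\
    exists2 mu, limit_measures f x mu & ~ observable f m dist B mu].
Proof.
move=> cM [_ dsym dtri dnbhs].
have ball_nbhs (e : R) : 0 < e -> forall mu : weak_star M,
    nbhs mu [set nu : weak_star M | dist mu nu < e].
  by move=> e0 mu; rewrite dnbhs; exists e.
have /choice[D DP] n : exists D : set (probability (borel M) R), finite_set D /\
    forall mu, exists2 nu, D nu & dist nu mu < n.+1%:R^-1.
  have [|D fD DP] := compact_finite_net (weak_star_compact cM)
    (ball_nbhs n.+1%:R^-1 _); first by [].
  by exists D.
pose A n nu : set (borel M) := [set x | B x /\
  limit_measures f x `&` [set rho | dist nu rho < n.+1%:R^-1] !=set0].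
pose Z n : set (borel M) :=
  \bigcup_(nu in [set nu | D n nu /\ (m^* (A n nu))%mu = 0%E]) A n nu.
apply: (negligibleS (A := \bigcup_n Z n)); last first.
  apply: negligible_bigcup => n; rewrite /Z; set E := mkset _.
  have : countable E.
    by apply: finite_set_countable; apply: sub_finite_set (DP n).1 => nu [].
  move=> /pfcard_geP[->|[s]]; first by rewrite bigcup_set0; exact: negligible_set0.
  apply: (negligibleS (A := \bigcup_k A n (s k))).
    move=> x [nu Enu xnu]; have [k _ sk] := @surj _ _ _ _ s _ Enu.
    by exists k => //; rewrite sk.
  apply: negligible_bigcup => k; apply: outer_measure0_negligible.
  by have [] : E (s k) by exact: funS.
move=> x [Bx [mu xmu nobs]]; apply: contrapT => nZ; apply: nobs => e e0.
have [n ne] : exists n, n.+1%:R^-1 + n.+1%:R^-1 < e.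
  have [n] := ltr_add_invr (divr_gt0 e0 (ltr0n R 2)).
  by rewrite add0r => ne; exists n; rewrite [e]splitr ltrD.
have [nu Dnu numu] := (DP n).2 mu.
have Ax : A n nu x by split=> //; exists mu.
(* The ball around [nu] lies in the [e]-ball around [mu], as both radii [1 / (n + 1)] sum to less
   than [e]. Its set [A n nu] is not null, since otherwise [x] would belong to [Z n]. *)
apply: (@lt_le_trans _ _ (m^* (A n nu))%mu).
  rewrite lt_neqAle mu_ext_ge0// andbT; apply/eqP => mA0.
  by apply: nZ; exists n => //; exists nu.
apply: le_mu_ext => z [Bz [rho [zrho /= nurho]]]; split=> //.
exists rho; split=> //=; rewrite (le_lt_trans (dtri _ nu _))//.
by rewrite (lt_trans _ ne)// ltrD// dsym.
Qed.

(** * Limit measures along prescribed times *)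

Lemma limn_esup_ge0_frequently (R : realType) (u : (\bar R)^nat) (e : R)
    (N : nat) :
  0 < e -> ~~ (limn_esup u < 0)%E -> exists2 n, (N <= n)%N & ((- e)%:E < u n)%E.
Proof.
move=> e0 u0; apply: contrapT => noN; move/negP: u0; apply.
apply: (@le_lt_trans _ _ (- e)%:E); last by rewrite lte_fin oppr_lt0.
rewrite limn_esup_lim; apply: lime_le; first exact: is_cvg_esups.
exists N => // k /= Nk; apply: ge_ereal_sup => _ [n /= kn <-].
by rewrite leNgt; apply/negP => un; apply: noN; exists n => //; exact: leq_trans kn.
Qed.

(** Weak* compactness gives a cluster point of the empirical measures at admissible times, and the
    metric extracts a convergent subsequence. The first index of [P] lets the requirement on the
    times tighten along it. *)
Lemma exists_limit_measure (R : realType) (M : pmetricType R)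
    (dist : probability (borel M) R -> probability (borel M) R -> R)
    (f : M -> M) (x : M) (P : nat -> nat -> Prop) :
  compact [set: M] -> weak_star_metric dist ->
  (forall i j n, (i <= j)%N -> P j n -> P i n) ->
  (forall N, exists2 n, (N <= n)%N & P N n) ->
  exists (mu : probability (borel M) R) (k : nat -> nat),
    [/\ {homo k : i j / (i < j)%N}, forall i, P i (k i) &
      (fun i => (empirical f x (k i) : probability (borel M) R) : weak_star M)
      @ \oo --> (mu : weak_star M)].
Proof.
move=> cM [_ _ _ dnbhs] Pmono Pex.
pose emp n : weak_star M := (empirical f x n : probability (borel M) R).
pose tail N : set (weak_star M) :=
  [set nu | exists n, [/\ (N <= n)%N, P N n & nu = emp n]].
pose F := filter_from [set: nat] tail.
have FF : ProperFilter F.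
  apply: filter_from_proper; last first.
    by move=> N _; have [n Nn Pn] := Pex N; exists (emp n), n.
  apply: filter_from_filter; first by exists 0%N.
  move=> i j _ _; exists (maxn i j) => // _ [n [+ Pn ->]].
  rewrite geq_max => /andP[iN jN]; split; exists n; split=> //.
    by apply: Pmono Pn; exact: leq_maxl.
  by apply: Pmono Pn; exact: leq_maxr.
have [mu [_ Fmu]] := weak_star_compact cM FF filterT.
have /choice[q qP] N : exists n,
    [/\ (N <= n)%N, P N n & dist mu (emp n) < N.+1%:R^-1].
  have nmu : nbhs mu [set nu : weak_star M | dist mu nu < N.+1%:R^-1].
    by rewrite dnbhs; exists N.+1%:R^-1; rewrite //= invr_gt0.
  have FN : F (tail N) by exists N.
  have [_ [[n [Nn Pn ->]] /= dn]] := Fmu _ _ FN nmu.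
  by exists n.
(* Restarting the choice from [(k i).+1] makes [k] strictly increasing; then [i <= k i], and the
   requirements at rank [k i + 1] imply those at rank [i + 1]. *)
pose k := fix k i := if i is i'.+1 then q (k i').+1 else q 0%N.
have kS i : (k i < k i.+1)%N by have [] := qP (k i).+1.
have k_homo : {homo k : i j / (i < j)%N} by apply: homo_ltn => //; exact: ltn_trans.
have ik i : (i <= k i)%N.
  by elim: i => // i IH; exact: leq_ltn_trans IH (kS i).
have kP i : P i (k i) /\ dist mu (emp (k i)) < i.+1%:R^-1.
  case: i => [|i] /=; first by have [] := qP 0%N.
  have [_ Pk dk] := qP (k i).+1; split; first by apply: Pmono Pk; rewrite ltnS.
  by rewrite (lt_le_trans dk)// lef_pV2 ?posrE// ler_nat !ltnS.
exists mu, k; split=> //; first by move=> i; have [] := kP i.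
move=> A; rewrite dnbhs => -[e /= e0 eA].
suff : \forall i \near \oo, A (emp (k i)) by [].
near=> i; apply: eA => /=.
have [_ dk] := kP i; rewrite (lt_trans dk)//; near: i.
exact: (near_infty_natSinv_lt (PosNum e0)).
Unshelve. all: end_near. Qed.

(** * Negative growth at almost every point of the basin *)

Theorem theorem2p13 (R : realType) (M : pmetricType R) (d : nat)
    (atlas : set (chart R M d)) (m : probability (borel M) R)
    (dist : probability (borel M) R -> probability (borel M) R -> R)
    (f : M -> M) (phi : nat -> M -> R) (alpha : R) (K : set M) :
  compact_manifold atlas ->
  is_lebesgue atlas m ->
  weak_star_metric dist ->
  continuous f ->
  subadditive_potential f phi ->
  0 < alpha <= 1 ->
  observable_attractor f m alpha K ->
  (forall mu : probability (borel M) R, observable f m dist (basin f K) mu ->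
    {ae mu, forall x : M,
      cvgn (growth phi x) /\ (limn (growth phi x) < 0)%E}) ->
  {ae m, forall x : M, basin f K x -> (limn_esup (growth phi x) < 0)%E}.
Proof.
move=> [cM _ _ _] _ wdist _ sub _ _ growth_lt0.
apply: (negligibleS _ (negligible_not_observable m f (basin f K) cM wdist)).
move=> x /= /not_implyP[Bx /negP x_ge0]; split=> //.
(* The times are those where the growth exceeds [- 1 / (i + 1)]. The potential is taken at [n + 1]
   because [empirical f x n] averages [n + 1] points. *)
have [|N|mu [k [k_homo kP mu_lim]]] := @exists_limit_measure R M dist f x
    (fun i n => - (i.+1%:R^-1 : R) < n.+1%:R^-1 * phi n.+1 x) cM wdist.
- move=> i j n ij; apply: le_lt_trans.
  by rewrite lerN2 lef_pV2 ?posrE// ler_nat.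
(* The threshold [N + 1] forces a nonzero index, which can then be written [n + 1] with [N <= n]. *)
- have [] := limn_esup_ge0_frequently (e := N.+1%:R^-1) N.+1 _ x_ge0; first by [].
  by move=> [//|n] Nn; rewrite lte_fin => ?; exists n.
exists mu; first by exists k.
move=> /growth_lt0 /(exists_integral_lt0 cM sub)[l l0 int_lt0].
have [C avg] := subadditive_average cM sub l0.
have cphi : continuous (phi l) by exact: sub.1.
have /weak_star_cvgP /(_ _ cphi) := mu_lim.
have c0 : 0 < - (\int[mu]_x phi l x) / 2 by rewrite divr_gt0 ?oppr_gt0.
move=> /cvgrPdist_lt /(_ _ c0) int_lim.
have ik i : (i <= k i)%N.
  by elim: i => // i IH; exact: leq_ltn_trans IH (k_homo _ _ (ltnSn i)).
have : \forall i \near \oo, False.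
  near=> i.
  have : i.+1%:R^-1 * (l%:R + `|C|) < - (\int[mu]_x phi l x) / 2.
    rewrite -ltr_pdivlMr ?ltr_wpDr ?ltr0n//; near: i.
    have e0 : 0 < - (\int[mu]_x phi l x) / 2 / (l%:R + `|C|).
      by rewrite divr_gt0// ltr_wpDr ?ltr0n.
    exact: (near_infty_natSinv_lt (PosNum e0)).
  have /= : `|\int[mu]_x phi l x - \int[empirical f x (k i)]_y phi l y| <
      - (\int[mu]_x phi l x) / 2 by near: i.
  rewrite integral_empirical; last exact: continuous_borel_measurable.
  set n := (k i).+1; set S := \sum_(j < n) _; set I := \int[mu]_x _.
  move=> /ltr_normlP[IS _] small.
  have n0 : 0 < (n%:R : R)^-1 by rewrite invr_gt0 ltr0n.
  have := avg n x isT; rewrite -/S -(ler_pM2l n0) mulrDr mulrCA => avg_n.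
  have growth_n : - (i.+1%:R^-1 * l%:R) <= l%:R * (n%:R^-1 * phi n x).
    by rewrite -mulNr mulrC ler_wpM2l// ltW// kP.
  have Cn : n%:R^-1 * C <= i.+1%:R^-1 * `|C|.
    rewrite (le_trans (ler_wpM2l (ltW n0) (ler_norm C)))// ler_wpM2r//.
    by rewrite lef_pV2 ?posrE// ler_nat ltnS.
  (* Here [u] is [l] times the growth, at least [- p], and the orbit average [a] is below [I' / 2].
     Thus [- p <= u <= a + b < I' / 2 + q], against [p + q < - I' / 2]. *)
  have arith (I' a b p q u : R) : - (I' - a) < - I' / 2 -> p + q < - I' / 2 ->
      u <= a + b -> - p <= u -> b <= q -> (0 : R) < 0.
    by clear; lra.
  rewrite mulrDr in small.
  suff : (0 : R) < 0 by rewrite ltxx.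
  exact: arith IS small avg_n growth_n Cn.
by case=> i _ /(_ i (leqnn i)).
Unshelve. all: end_near. Qed.
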